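(* Let $L\in\mathbb{R}^{n\times n}$ be a Laplacian matrix and $\bar J=(\bar J_{ij})_{n\times n}=L^\vdash$ its eigenprojection. Let $K=I-E$, where $E=\tfrac1n\mathbf 1\mathbf 1^{\mathrm T}$. For $\delta>0$ let $\boldsymbol x(t)=(x_1(t),\ldots,x_n(t))^{\mathrm T}$, $t\ge0$, be the solution of $$\dot{\boldsymbol x}(t)=-(L+\delta K)\,\boldsymbol x(t)$$ with initial state $\boldsymbol x(0)\in\mathbb R^n$ (fixed independently of $\delta$). Then: 1. $\displaystyle\lim_{t\to\infty}\boldsymbol x(t)=\mathbf 1\,\frac1n\sum_{j=1}^n s_j^\delta\,x_j(0)$, where $s_j^\delta$ is the $j$th column sum of $\big(I+\tfrac1\delta L\big)^{-1}$; 2. $\displaystyle\lim_{\delta\to+0}\lim_{t\to\infty}\boldsymbol x(t)=\mathbf 1\,\frac1n\sum_{j=1}^n\bar J_{\cdot j}\,x_j(0)$, where $\bar J_{\cdot j}=\sum_{i=1}^n\bar J_{ij}$, $j=1,\ldots,n$.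
   Context: A Laplacian matrix is a real square matrix with nonpositive off-diagonal entries and zero row sums. For a square matrix $A$ let $\nu$ be its index, i.e. the smallest $k\in\{0,1,\ldots\}$ with $\operatorname{rank}A^{k+1}=\operatorname{rank}A^k$ (where $A^0=I$); the eigenprojection $A^\vdash$ of $A$ (corresponding to the eigenvalue $0$) is the unique idempotent matrix with range $\mathcal R(A^\vdash)=\mathcal N(A^\nu)$ and null space $\mathcal N(A^\vdash)=\mathcal R(A^\nu)$. $\mathbf 1$ is the all-ones column vector of length $n$ and $I$ is the identity matrix of order $n$. *)

(* Defs.v *)
From HB Require Import structures.
From mathcomp Require Import all_boot all_order all_algebra.
From mathcomp Require Import all_classical all_reals all_analysis.

Set Implicit Arguments.
Unset Strict Implicit.
Unset Printing Implicit Defensive.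

Import Order.TTheory GRing.Theory Num.Theory.
Import numFieldNormedType.Exports.
Local Open Scope classical_set_scope.
Local Open Scope ring_scope.

Definition is_laplacian (R : realType) (n : nat) (L : 'M[R]_n) : Prop :=
  (forall i j, i != j -> L i j <= 0) /\ (forall i, \sum_j L i j = 0).

(* Matrices act on column vectors; mxalgebra's row-space operations are not
   used for the range and the null space. *)
Definition mx_range (R : realType) (m n : nat) (A : 'M[R]_(m, n)) :
  set 'cV[R]_m := range (fun y : 'cV[R]_n => A *m y).

Definition mx_null (R : realType) (m n : nat) (A : 'M[R]_(m, n)) :
  set 'cV[R]_n := [set x | A *m x = 0].

Lemma mx_index_subproof (R : realType) (n : nat) (A : 'M[R]_n) :
  exists k, \rank (A ^+ k.+1) == \rank (A ^+ k).
Proof.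
apply: contrapT => H.
have lt_rank k : (\rank (A ^+ k.+1) < \rank (A ^+ k))%N.
  rewrite ltn_neqAle; apply/andP; split.
    by apply/negP => Hk; apply: H; exists k.
  by rewrite exprS; exact: mxrankM_maxr.
have bnd k : (\rank (A ^+ k) + k <= n)%N.
  elim: k => [|k IHk]; first by rewrite addn0 rank_leq_row.
  by apply: leq_trans IHk; rewrite addnS -addSn leq_add2r.
by have := leq_trans (leq_addl _ _) (bnd n.+1); rewrite ltnn.
Qed.

Definition mx_index (R : realType) (n : nat) (A : 'M[R]_n) : nat :=
  ex_minn (mx_index_subproof A).

Definition is_eigenprojection (R : realType) (n : nat) (A P : 'M[R]_n) : Prop :=
  [/\ P *m P = P,
      mx_range P = mx_null (A ^+ mx_index A)
    & mx_null P = mx_range (A ^+ mx_index A)].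

Lemma mx_index_rank_sqr (R : realType) (n : nat) (A : 'M[R]_n) :
  \rank (A ^+ mx_index A *m A ^+ mx_index A) = \rank (A ^+ mx_index A).
Proof.
rewrite /mx_index; case: ex_minnP => v /eqP Hv _.
have rk k : \rank (A ^+ (v + k).+1) = \rank (A ^+ (v + k)).
  elim: k => [|k IHk]; first by rewrite addn0.
  have le1 : (A ^+ (v + k).+1 <= A ^+ (v + k))%MS by rewrite exprS submxMl.
  have := mxrank_leqif_eq le1; rewrite IHk => -[_]; rewrite eqxx => /esym.
  move=> /eqmxP eqA.
  rewrite addnS [in RHS]exprSr exprSr.
  by apply: eqmx_rank; apply/eqmxP; exact: eqmxMr eqA.
have rk0 k : \rank (A ^+ (v + k)) = \rank (A ^+ v).
  by elim: k => [|k IHk]; rewrite ?addn0 // addnS rk.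
by rewrite -(rk0 v) exprD.
Qed.

Lemma eigenprojection_exists_unique (R : realType) (n : nat) (A : 'M[R]_n) :
  exists! P : 'M[R]_n, is_eigenprojection A P.
Proof.
set B := A ^+ mx_index A.
have rkB : \rank (B *m B) = \rank B by exact: mx_index_rank_sqr.
set C := B^T.
have rkC : \rank (C *m C) = \rank C by rewrite -trmx_mul !mxrank_tr.
have cap1 : (C :&: kermx C)%MS = 0.
  have := mxrank_mul_ker C C; rewrite rkC -[RHS]addn0 => /addnI /eqP.
  by rewrite mxrank_eq0 => /eqP.
have cap2 : (kermx C :&: C)%MS = 0 by apply/eqP; rewrite -submx0 capmxC cap1.
have full : row_full (kermx C + C)%MS.
  have := mxrank_sum_cap (kermx C) C.
  rewrite cap2 mxrank0 addn0 mxrank_ker subnK ?rank_leq_row // => h.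
  by rewrite /row_full h.
set Q := proj_mx (kermx C) C.
have nullB (x : 'cV[R]_n) : B *m x = 0 <-> (x^T <= kermx C)%MS.
  split=> [h|/sub_kermxP h]; first by apply/sub_kermxP; rewrite -trmx_mul h trmx0.
  by apply: trmx_inj; rewrite trmx_mul h trmx0.
have rngB (x : 'cV[R]_n) : mx_range B x <-> (x^T <= C)%MS.
  split=> [[y _ <-]|/submxP [y h]]; first by rewrite trmx_mul submxMl.
  by exists y^T => //; apply: trmx_inj; rewrite h trmx_mul trmxK.
exists Q^T; split.
  split.
  - rewrite -trmx_mul; congr trmx; exact: proj_mx_proj cap2.
  - apply/seteqP; split=> x.
      by move=> [y _ <-]; apply/nullB; rewrite trmx_mul trmxK; exact: proj_mx_sub.
    move=> /nullB h; exists x => //; apply: trmx_inj.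
    by rewrite trmx_mul trmxK proj_mx_id.
  - apply/seteqP; split=> x.
      move=> h; apply/rngB.
      have := proj_mx_compl_sub (submx_full x^T full).
      have -> : x^T *m proj_mx (kermx C) C = 0.
        by apply: trmx_inj; rewrite trmx_mul trmxK trmx0.
      by rewrite subr0.
    move=> /rngB h; apply: trmx_inj.
    by rewrite trmx_mul trmxK trmx0 proj_mx_0.
move=> P [PP rP nP].
apply: trmx_inj; rewrite trmxK; apply/row_matrixP => i.
have PxE (x : 'cV[R]_n) : (P *m x)^T = x^T *m Q.
  have h1 : ((P *m x)^T <= kermx C)%MS.
    by apply/nullB; have : mx_range P (P *m x) by [exists x]; rewrite rP.
  have h2 : ((x - P *m x)^T <= C)%MS.
    apply/rngB; rewrite /B -nP /mx_null /=.
    by rewrite mulmxBr mulmxA PP subrr.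
  have -> : x^T = (P *m x)^T + (x - P *m x)^T by rewrite -linearD /= addrC subrK.
  by rewrite mulmxDl (proj_mx_id cap2 h1) (proj_mx_0 cap2 h2) addr0.
have := PxE (delta_mx i 0).
by rewrite trmx_mul trmx_delta -!rowE => ->.
Qed.

Definition ones (R : realType) (n : nat) : 'cV[R]_n := const_mx 1.

Definition avg_mx (R : realType) (n : nat) : 'M[R]_n :=
  n%:R^-1 *: (ones R n *m (ones R n)^T).

Definition centering_mx (R : realType) (n : nat) : 'M[R]_n :=
  1%:M - avg_mx R n.

(* x solves x'(t) = A x(t) for t >= 0 with x(0) = x0; at t = 0 the derivative
   is the right one, and the values of x at negative times are irrelevant. *)
Definition is_linear_flow (R : realType) (n : nat) (A : 'M[R]_n)
    (x0 : 'cV[R]_n) (x : R -> 'cV[R]_n) : Prop :=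
  [/\ x 0 = x0,
      h^-1 *: (x h - x 0) @[h --> 0^'+] --> A *m x 0
    & forall t : R, 0 < t -> is_derive t 1 x (A *m x t)].

(* Main.v *)
Require Import Defs.
From HB Require Import structures.
From mathcomp Require Import all_boot all_order all_algebra.
From mathcomp Require Import all_classical all_reals all_analysis.
From mathcomp Require Import lra ring.

Set Implicit Arguments.
Unset Strict Implicit.
Unset Printing Implicit Defensive.

Import Order.TTheory GRing.Theory Num.Theory.
Import numFieldNormedType.Exports.
Local Open Scope classical_set_scope.
Local Open Scope ring_scope.

(* Both limits rest on the maximum principle: at a largest coordinate of v the
   Laplacian product L v is nonnegative.  Applied to v + tau L v = w it gives
   max |v| <= max |w|, so (I + tau L)^-1 exists and is bounded uniformly in tau.
   Applied to the flow it makes every difference x_i - x_j decay exponentially.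
   The row vector p = (1/n) 1^T (I + L/delta)^-1 satisfies p 1 = 1 and
   p (L + delta K) = 0, so p x(t) is constant and all the coordinates of x(t)
   tend to p x(0).  For delta -> 0, the uniform bound forces N(L^2) = N(L);
   hence L Jbar = 0, and v - Jbar v = L y for some y, which gives
   (I + L/delta)^-1 v = Jbar v + delta (y - (I + L/delta)^-1 y). *)

(** * Maximum principle for Laplacian matrices and bounds on the resolvent *)

Lemma exists_max_coord (R : realType) (n : nat) (v : 'cV[R]_n) (i0 : 'I_n) :
  exists i, forall j, v j 0 <= v i 0.
Proof.
case: (@Order.TotalTheory.arg_maxP _ _ _ i0 xpredT (fun i => v i 0) isT).
by move=> i _ h; exists i => j; exact: h.
Qed.

Lemma coord_le_sum_norm (R : realType) (n : nat) (v : 'cV[R]_n) (i : 'I_n) :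
  `|v i 0| <= \sum_k `|v k 0|.
Proof. by rewrite (bigD1 i)//= lerDl sumr_ge0. Qed.

(** Zero row sums give (L v)_i = sum_j L_ij (v_j - v_i). The term j = i vanishes and every other one
    is a product of two nonpositive numbers. *)
Lemma laplacian_mul_argmax_ge0 (R : realType) (n : nat) (L : 'M[R]_n)
    (v : 'cV[R]_n) (i : 'I_n) :
  is_laplacian L -> (forall j, v j 0 <= v i 0) -> 0 <= (L *m v) i 0.
Proof.
move=> [Loff Lsum] vi.
have -> : (L *m v) i 0 = \sum_j L i j * (v j 0 - v i 0).
  under [RHS]eq_bigr do rewrite mulrBr.
  by rewrite sumrB -mulr_suml Lsum mul0r subr0 mxE.
apply: sumr_ge0 => j _; have [->|ij] := eqVneq j i.
  by rewrite subrr mulr0.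
by apply: mulr_le0; [apply: Loff; rewrite eq_sym | rewrite subr_le0].
Qed.

Lemma laplacian_mul_argmin_le0 (R : realType) (n : nat) (L : 'M[R]_n)
    (v : 'cV[R]_n) (i : 'I_n) :
  is_laplacian L -> (forall j, v i 0 <= v j 0) -> (L *m v) i 0 <= 0.
Proof.
move=> Llap vi; have := @laplacian_mul_argmax_ge0 R n L (- v) i Llap.
by rewrite mulmxN !mxE oppr_ge0; apply=> j; rewrite !mxE lerN2.
Qed.

Lemma laplacian_mul_ones (R : realType) (n : nat) (L : 'M[R]_n) :
  is_laplacian L -> L *m ones R n = 0.
Proof.
move=> [_ Lsum]; apply/matrixP => i j; rewrite !mxE.
by rewrite -[RHS](Lsum i); apply: eq_bigr => k _; rewrite mxE mulr1.
Qed.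

(** At an index k of a largest coordinate, (L v)_k >= 0, hence v_k <= w_k <= c. The lower bound is
    the same argument for -v. That c does not depend on [tau] is what both uses with [tau] tending
    to infinity rely on. *)
Lemma resolvent_bound (R : realType) (n : nat) (L : 'M[R]_n) (tau c : R)
    (v w : 'cV[R]_n) :
  is_laplacian L -> 0 <= tau -> (1%:M + tau *: L) *m v = w ->
  (forall i, `|w i 0| <= c) -> forall i, `|v i 0| <= c.
Proof.
move=> Llap tau0.
suff ub (v' w' : 'cV[R]_n) : (1%:M + tau *: L) *m v' = w' ->
    (forall i, w' i 0 <= c) -> forall i, v' i 0 <= c.
  move=> vw wc i; rewrite ler_norml lerNl; apply/andP; split.
    have := ub (- v) (- w); rewrite mulmxN vw => /(_ erefl) h.
    have := h _ i; rewrite mxE; apply => k; rewrite mxE.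
    by rewrite (le_trans _ (wc k))// -normrN ler_norm.
  by apply: (ub v w) => // k; exact: le_trans (ler_norm _) (wc k).
move=> <- wc i; have [k vk] := exists_max_coord v' i.
apply: le_trans (vk i) (le_trans _ (wc k)).
rewrite mulmxDl mul1mx -scalemxAl !mxE lerDl.
by have := laplacian_mul_argmax_ge0 Llap vk; rewrite mxE => h; apply: mulr_ge0.
Qed.

Lemma resolvent_unitmx (R : realType) (n : nat) (L : 'M[R]_n) (tau : R) :
  is_laplacian L -> 0 <= tau -> 1%:M + tau *: L \in unitmx.
Proof.
move=> Llap tau0; rewrite -unitmx_tr -row_free_unit; apply/inj_row_free => v h.
have {h} hv : (1%:M + tau *: L) *m v^T = 0.
  by apply: trmx_inj; rewrite trmx_mul trmxK trmx0.
(* The bound with c = 0 forces a kernel vector to vanish. *)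
apply/rowP => i; rewrite mxE; apply/eqP; rewrite -normr_le0.
have := @resolvent_bound R n L tau 0 _ _ Llap tau0 hv _ i.
by rewrite mxE; apply => j; rewrite mxE normr0.
Qed.

(** * Null space and eigenprojection of a Laplacian matrix *)

Lemma laplacian_sqr_eq0 (R : realType) (n : nat) (L : 'M[R]_n) (u : 'cV[R]_n) :
  is_laplacian L -> L *m (L *m u) = 0 -> L *m u = 0.
Proof.
(* (I + tau L) (u - tau L u) = u, so u - tau L u stays bounded as tau grows. *)
move=> Llap LLu.
set c := \sum_k `|u k 0|.
have bnd tau i : 0 <= tau -> `|u i 0 - tau * (L *m u) i 0| <= c.
  move=> tau0.
  have -> : u i 0 - tau * (L *m u) i 0 = (u - tau *: (L *m u)) i 0.
    by rewrite !mxE.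
  apply: (@resolvent_bound _ _ L tau _ _ u Llap tau0); last first.
    exact: coord_le_sum_norm.
  rewrite mulmxDl mul1mx mulmxBr -!scalemxAl -scalemxAr LLu !scaler0 subr0.
  by rewrite subrK.
apply/matrixP => i j; rewrite ord1 [RHS]mxE; apply/eqP/negPn/negP => Lui.
have c0 : 0 <= c by apply: sumr_ge0.
have a0 : 0 < `|(L *m u) i 0| by rewrite normr_gt0.
(* This [tau] makes |tau (L u)_i| equal to 2c + 1, while the bound allows at most 2c. *)
have t0 : 0 <= (c + c + 1) / `|(L *m u) i 0| by apply: divr_ge0 => //; lra.
have := bnd _ i t0; have := coord_le_sum_norm u i; rewrite -/c => uc h.
have : `|(c + c + 1) / `|(L *m u) i 0| * (L *m u) i 0| <= c + c.
  by rewrite -[X in `|X|](subKr (u i 0)) (le_trans (ler_normB _ _))// lerD.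
rewrite normrM ger0_norm// divfK ?gt_eqF//; lra.
Qed.

(** As N(L^2) = N(L), all positive powers of L have the null space of L, so the range of P lies in
    N(L). Since the index is positive, N(P) = R(L^nu) lies in R(L), and it contains v - P v. *)
Lemma eigenprojection_laplacian (R : realType) (n : nat) (L P : 'M[R]_n) :
  (0 < n)%N -> is_laplacian L -> is_eigenprojection L P ->
  L *m P = 0 /\ forall v : 'cV[R]_n, exists y, v - P *m v = L *m y.
Proof.
move=> n0 Llap [PP rP nP].
have powE k (u : 'cV[R]_n) : L ^+ k.+1 *m u = 0 -> L *m u = 0.
  elim: k u => [|k IH] u; first by rewrite expr1.
  rewrite exprSr -mulmxA => /IH; exact: laplacian_sqr_eq0.
(* Index 0 would make L invertible, although L annihilates the nonzero vector [ones R n]. *)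
have : mx_index L != 0%N.
  rewrite /mx_index; case: ex_minnP => k /eqP rk _; apply/eqP => k0.
  move: rk; rewrite k0 expr0 expr1 mxrank1 => rL.
  have Lu : L \in unitmx by rewrite -row_free_unit /row_free rL.
  have /(congr1 (mulmx (invmx L))) := laplacian_mul_ones Llap.
  rewrite mulKmx// mulmx0 => /matrixP/(_ (Ordinal n0) 0)/eqP.
  by rewrite !mxE oner_eq0.
case: (mx_index L) rP nP => // k rP nP _; split.
  apply/matrixP => i j.
  have : mx_range P (P *m delta_mx j (0 : 'I_1)) by exists (delta_mx j 0).
  rewrite rP /mx_null /= => /powE; rewrite mulmxA -colE => /matrixP/(_ i 0).
  by rewrite !mxE.
move=> v.
have : mx_null P (v - P *m v) by rewrite /mx_null /= mulmxBr mulmxA PP subrr.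
rewrite nP => -[y _ <-]; exists (L ^+ k *m y).
by rewrite exprS mulmxA.
Qed.

(** * Limits and derivatives of vector functions through scalar functionals *)

Lemma cvg_row_mul (R : realType) (T : Type) (F : set_system T) (FF : Filter F)
    (n : nat) (p : 'rV[R]_n) (f : T -> 'cV[R]_n) (l : 'cV[R]_n) :
  f @ F --> l -> (p *m f t) 0 0 @[t --> F] --> (p *m l) 0 0.
Proof.
move=> fl.
have E (v : 'cV[R]_n) : (p *m v) 0 0 = \sum_j p 0 j * v j 0 by rewrite mxE.
rewrite E; under eq_cvg do rewrite E.
apply: cvg_big => [|j _]; first exact: add_continuous.
apply: cvgMl_tmp.
exact: (cvg_comp f (fun v : 'cV[R]_n => v j 0) fl
  (@coord_continuous R n 1 j 0 l)).
Qed.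

Lemma cvg_col_coord (R : realType) (T : Type) (F : set_system T)
    (FF : Filter F) (n : nat) (f : T -> 'cV[R]_n) (l : 'cV[R]_n) :
  (forall i, f t i 0 @[t --> F] --> l i 0) -> f @ F --> l.
Proof.
move=> fl; apply/cvgrPdist_le => /= e e0; near=> t.
rewrite /Num.Def.normr/= mx_normrE (bigmax_le _ (ltW e0))//= => -[i j] _.
rewrite ord1 !mxE/=; move: i; near: t; apply: filter_forall => /= i.
exact: ((cvgrPdist_le _ _).1 (fl i)).
Unshelve. all: by end_near. Qed.

Lemma is_derive_row_mul (R : realType) (n : nat) (p : 'rV[R]_n)
    (x : R -> 'cV[R]_n) (t : R) (dx : 'cV[R]_n) :
  is_derive t 1 x dx ->
  is_derive t 1 (fun s => (p *m x s) 0 0) ((p *m dx) 0 0).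
Proof.
move=> [dfx <-].
have h : (p *m (h^-1 *: ((x \o shift t) (h *: 1) - x t))) 0 0 @[h --> 0^']
    --> (p *m 'D_1 x t) 0 0 by apply: cvg_row_mul.
have {}h : h^-1 *: (((fun s => (p *m x s) 0 0) \o shift t) (h *: 1)
      - (p *m x t) 0 0) @[h --> 0^'] --> (p *m 'D_1 x t) 0 0.
  apply: cvg_trans h; apply: near_eq_cvg; near=> k.
  by rewrite -scalemxAr mulmxBr /= !mxE.
by apply: DeriveDef; [apply/cvg_ex; eexists; exact: h | exact/cvg_lim/h].
Unshelve. all: by end_near. Qed.

(** This reduces the flow to real functions, to which the extreme and mean value theorems apply. *)
Lemma linear_flow_row_mul (R : realType) (n : nat) (A : 'M[R]_n)
    (x0 : 'cV[R]_n) (x : R -> 'cV[R]_n) (p : 'rV[R]_n) :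
  is_linear_flow A x0 x ->
  {within `[0, +oo[, continuous (fun t => (p *m x t) 0 0)} /\
  forall t : R, 0 < t ->
    is_derive t 1 (fun s => (p *m x s) 0 0) ((p *m (A *m x t)) 0 0).
Proof.
move=> [_ dx0 dx]; split=> [|t t0]; last exact/is_derive_row_mul/dx.
apply/continuous_within_itvcyP; split=> [t|].
  rewrite in_itv/= andbT => t0.
  apply/differentiable_continuous/derivable1_diffP.
  by have [] := is_derive_row_mul p (dx _ t0).
apply: cvg_row_mul.
(* Right continuity at 0 comes from the one-sided derivative: x(h) is x(0) plus h times a convergent
   difference quotient. *)
have -> : x 0 = x 0 + 0 *: (A *m x 0) by rewrite scale0r addr0.
have : x 0 + h *: (h^-1 *: (x h - x 0)) @[h --> 0^'+] --> x 0 + 0 *: (A *m x 0).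
  apply: cvgD; first exact: cvg_cst.
  by apply: cvgZ dx0; exact: cvg_at_right_filter.
apply: cvg_trans; apply: near_eq_cvg; near=> h.
rewrite scalerA divff ?scale1r; first by rewrite addrC subrK.
by rewrite gt_eqF//; near: h; exact: nbhs_right_gt.
Unshelve. all: by end_near. Qed.

(** Left difference quotients divide a nonpositive number by a negative one. Staying on the left
    allows the maximum to sit at the right end of a time interval. *)
Lemma is_derive_left_max (R : realType) (f : R -> R) (a c d : R) :
  a < c -> (forall t, a <= t <= c -> f t <= f c) -> is_derive c 1 f d -> 0 <= d.
Proof.
move=> ac fc [dfc <-].
have /cvg_dnbhs_at_left h : h^-1 *: ((f \o shift c) (h *: 1) - f c)
    @[h --> 0^'] --> 'D_1 f c by exact: dfc.
apply: (cvgr_to_ge h); near=> k.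
have k0 : k < 0 by near: k; exact: nbhs_left_lt.
have kac : a - c < k by near: k; apply: nbhs_left_gt; rewrite subr_lt0.
apply: mulr_le0; first by rewrite invr_le0 ltW.
rewrite subr_le0/= [k *: 1]mulr1; apply: fc.
by apply/andP; split; lra.
Unshelve. all: by end_near. Qed.

(** * Exponential decay of the differences of coordinates *)

Lemma centering_mulE (R : realType) (n : nat) (v : 'cV[R]_n) (i : 'I_n) :
  (centering_mx R n *m v) i 0 = v i 0 - n%:R^-1 * \sum_j v j 0.
Proof.
rewrite mulmxBl mul1mx /avg_mx -scalemxAl -mulmxA !mxE big_ord1 !mxE mul1r.
by congr (_ - _ * _); apply: eq_bigr => j _; rewrite !mxE mul1r.
Qed.

Lemma spread_decay (R : realType) (n : nat) (L : 'M[R]_n) (delta : R)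
    (x0 : 'cV[R]_n) (x : R -> 'cV[R]_n) :
  is_laplacian L -> 0 < delta ->
  is_linear_flow (- (L + delta *: centering_mx R n)) x0 x ->
  exists C, forall i j t, 0 <= t ->
    (x t i 0 - x t j 0) * expR (delta / 2 * t) <= C.
Proof.
(* On [0, T], the largest value over all pairs and times is attained at time 0,
   or else it is nonpositive: a positive maximum at s > 0 would make i an argmax
   and j an argmin of x s, and then the derivative at s would be negative. *)
move=> Llap d0 xflow; have [x00 _ _] := xflow.
pose M := \sum_k `|x0 k 0|; exists (M + M) => i0 j0 T T0.
have M0 : 0 <= M by apply: sumr_ge0.
(* The weight grows at half the rate [delta] at which the centering term contracts differences; the
   other half keeps the derivative at a positive maximum strictly negative. *)
pose f (p : 'I_n * 'I_n) t := (x t p.1 0 - x t p.2 0) * expR (delta / 2 * t).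
pose r (p : 'I_n * 'I_n) : 'rV[R]_n := delta_mx 0 p.1 - delta_mx 0 p.2.
have rE p v : (r p *m v) 0 0 = v p.1 0 - v p.2 0.
  by rewrite mulmxBl -!rowE !mxE.
have fE p : f p = (fun t => (r p *m x t) 0 0) * (fun t => expR (delta / 2 * t)).
  by apply/funext => t; rewrite /f -rE.
have dexp (t : R) : is_derive t (1 : R) (fun s : R => expR (delta / 2 * s))
    (expR (delta / 2 * t) * (delta / 2)).
  apply: is_derive1_comp.
  by apply: is_derive_eq; rewrite /= scaler1.
have cf p : {within `[0, T], continuous f p}.
  rewrite fE => t; apply: continuousM; last first.
    apply: continuous_subspaceT => s.
    by apply/differentiable_continuous/derivable1_diffP; have [] := dexp s.
  apply: continuous_subspaceW (linear_flow_row_mul (r p) xflow).1 _.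
  by apply: subset_itvl; rewrite bnd_simp.
have /choice [c cP] p : exists c, [/\ 0 <= c, c <= T &
    forall t, 0 <= t <= T -> f p t <= f p c].
  have [c] := EVT_max T0 (cf p).
  rewrite in_itv/= => /andP[c0 cT] cmax; exists c; split=> //.
have [[i j] pmax] : exists p, forall q, f q (c q) <= f p (c p).
  case: (@Order.TotalTheory.arg_maxP _ _ _ (i0, j0) xpredT
    (fun p => f p (c p)) isT) => p _ h.
  by exists p => q; exact: h.
have [_ _ /(_ T)] := cP (i0, j0); rewrite T0 lexx => /(_ isT).
move=> /le_trans-/(_ _ (pmax _)) /le_trans; apply.
have [c0 cT cmax] := cP (i, j).
set s := c (i, j) in c0 cT cmax pmax *; set v := x s.
rewrite leNgt; apply/negP => Mlt.
have s0 : 0 < s.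
  rewrite lt_neqAle c0 andbT; apply/negP => /eqP s0.
  move: Mlt; rewrite -s0 /f x00 mulr0 expR0 mulr1 ltNge => /negP; apply.
  rewrite (le_trans (ler_norm _))// (le_trans (ler_normB _ _))//.
  by rewrite lerD// coord_le_sum_norm.
have e0 : 0 < expR (delta / 2 * s) by exact: expR_gt0.
have spread0 : 0 < v i 0 - v j 0.
  by rewrite -(pmulr_lgt0 _ e0); apply: le_lt_trans Mlt; rewrite addr_ge0.
(* At the common time s the exponential factor cancels, so (i, j) has the largest difference in [v];
   varying one index at a time makes i an argmax and j an argmin. *)
have spread p : v p.1 0 - v p.2 0 <= v i 0 - v j 0.
  rewrite -(ler_pM2r e0); apply: le_trans (pmax p).
  by have [_ _ h] := cP p; apply: h; rewrite c0 cT.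
have Li : 0 <= (L *m v) i 0.
  apply: laplacian_mul_argmax_ge0 => // k.
  by have := spread (k, j); rewrite /= lerD2r.
have Lj : (L *m v) j 0 <= 0.
  apply: laplacian_mul_argmin_le0 => // k.
  by have := spread (i, k); rewrite /= lerD2l lerN2.
have df := (linear_flow_row_mul (r (i, j)) xflow).2 _ s0.
have dge0 := is_derive_left_max s0 _ (is_deriveM df (dexp s)).
have /dge0 : forall t, 0 <= t <= s ->
    ((fun t => (r (i, j) *m x t) 0 0) * (fun t => expR (delta / 2 * t))) t <=
    ((fun t => (r (i, j) *m x t) 0 0) * (fun t => expR (delta / 2 * t))) s.
  move=> t /andP[t0 ts]; rewrite -fE; apply: cmax.
  by rewrite t0 (le_trans ts).
rewrite !rE /= mulNmx mulmxDl -scalemxAl.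
have E k : (- (L *m v + delta *: (centering_mx R n *m v))) k 0 =
    - (L *m v) k 0 - delta * (v k 0 - n%:R^-1 * \sum_l v l 0).
  by rewrite -centering_mulE !mxE opprD.
rewrite !E -/v /GRing.scale /=.
set m := _^-1 * _; set a := v i 0 in spread0 *; set b := v j 0 in spread0 *.
set e := expR _ in e0 *; set p := (L *m v) i 0 in Li *.
set q := (L *m v) j 0 in Lj *.
(* The mean [m] enters both coordinates alike and cancels. *)
have -> : (a - b) * (e * (delta / 2)) +
    e * (- p - delta * (a - m) - (- q - delta * (b - m))) =
    - (e * (p - q + delta / 2 * (a - b))) by field.
rewrite oppr_ge0 leNgt pmulr_rgt0// => /negP; apply.
by apply: ltr_wpDl; [lra | rewrite mulr_gt0// divr_gt0].
Qed.

(** * The conserved functional and the limit of the flow *)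

Definition mean_row (R : realType) (n : nat) : 'rV[R]_n :=
  n%:R^-1 *: (ones R n)^T.

Lemma mean_row_mulE (R : realType) (n : nat) (A : 'M[R]_n) (v : 'cV[R]_n) :
  (mean_row R n *m (A *m v)) 0 0 = n%:R^-1 * \sum_j (\sum_i A i j) * v j 0.
Proof.
rewrite -scalemxAl mulmxA !mxE; congr (_ * _); apply: eq_bigr => j _.
by rewrite !mxE; congr (_ * _); apply: eq_bigr => i _; rewrite !mxE mul1r.
Qed.

Lemma mean_row_ones (R : realType) (n : nat) :
  (0 < n)%N -> mean_row R n *m ones R n = 1.
Proof.
move=> n0; apply/matrixP => i j; rewrite !ord1 -scalemxAl !mxE.
under eq_bigr do rewrite !mxE mul1r.
by rewrite sumr_const card_ord -[1 *+ n]/(n%:R) mulVf// pnatr_eq0 -lt0n.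
Qed.

(** The row p of the overview; its jth entry is s_j^delta / n. *)
Definition consensus_row (R : realType) (n : nat) (L : 'M[R]_n) (delta : R) :
  'rV[R]_n := mean_row R n *m invmx (1%:M + delta^-1 *: L).

Lemma consensus_row_ones (R : realType) (n : nat) (L : 'M[R]_n) (delta : R) :
  (0 < n)%N -> is_laplacian L -> 0 < delta ->
  consensus_row L delta *m ones R n = 1.
Proof.
move=> n0 Llap d0.
have Ju : 1%:M + delta^-1 *: L \in unitmx.
  by apply: resolvent_unitmx => //; rewrite invr_ge0 ltW.
rewrite -mulmxA.
rewrite -[X in invmx _ *m X](_ : (1%:M + delta^-1 *: L) *m ones R n = _).
  by rewrite mulKmx// mean_row_ones.
by rewrite mulmxDl mul1mx -scalemxAl laplacian_mul_ones// scaler0 addr0.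
Qed.

(** With m = [mean_row R n], the definition of p gives p L = delta (m - p), while p 1 = 1 gives p K
    = p - m; the two contributions cancel. *)
Lemma consensus_row_left_null (R : realType) (n : nat) (L : 'M[R]_n)
    (delta : R) :
  (0 < n)%N -> is_laplacian L -> 0 < delta ->
  consensus_row L delta *m (L + delta *: centering_mx R n) = 0.
Proof.
move=> n0 Llap d0; set p := consensus_row L delta.
have Ju : 1%:M + delta^-1 *: L \in unitmx.
  by apply: resolvent_unitmx => //; rewrite invr_ge0 ltW.
have pJ : p + delta^-1 *: (p *m L) = mean_row R n.
  by rewrite scalemxAr -[X in X + _]mulmx1 -mulmxDr mulmxKV.
have pL : p *m L = delta *: (mean_row R n - p).
  by rewrite -pJ addrC addKr scalerA divff ?scale1r// gt_eqF.
rewrite mulmxDr pL -scalemxAr -scalerDr mulmxBr mulmx1 /avg_mx -scalemxAr.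
rewrite mulmxA consensus_row_ones// mul1mx.
by rewrite addrA subrK subrr scaler0.
Qed.

(** With c = p x(0) = p x(t) and p 1 = 1, one has x_i(t) = c + sum_j p_j (x_i(t) - x_j(t)), and
    every difference tends to 0. *)
Lemma flow_cvg (R : realType) (n : nat) (L : 'M[R]_n) (delta : R)
    (x0 : 'cV[R]_n) (x : R -> 'cV[R]_n) :
  (0 < n)%N -> is_laplacian L -> 0 < delta ->
  is_linear_flow (- (L + delta *: centering_mx R n)) x0 x ->
  x t @[t --> +oo] --> (consensus_row L delta *m x0) 0 0 *: ones R n.
Proof.
move=> n0 Llap d0 xflow; set p := consensus_row L delta.
have [x00 _ _] := xflow.
have pconst t : 0 <= t -> (p *m x t) 0 0 = (p *m x0) 0 0.
  move=> t0; have [cf df] := linear_flow_row_mul p xflow.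
  have [||s _] := @MVT_segment R (fun s => (p *m x s) 0 0) (fun=> 0) _ _ t0.
  - move=> s; rewrite in_itv/= => /andP[s0 _]; apply: is_derive_eq (df s s0) _.
    by rewrite mulmxA mulmxN consensus_row_left_null// oppr0 mul0mx mxE.
  - by apply: continuous_subspaceW cf; apply: subset_itvl; rewrite bnd_simp.
  by rewrite mul0r x00 => /eqP; rewrite subr_eq0 => /eqP.
have [C xC] := spread_decay Llap d0 xflow.
have spread0 i j : x t i 0 - x t j 0 @[t --> +oo] --> (0 : R).
  have Cexp : C * expR (- (delta / 2 * t)) @[t --> +oo] --> (0 : R).
    rewrite -[X in _ --> X](mulr0 C); apply: cvgMl_tmp.
    apply: (cvg_comp (fun t : R => delta / 2 * t) (fun t : R => expR (- t)) _
      (@cvgr_expR R)).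
    under eq_cvg do rewrite mulrC.
    by apply: gt0_cvgMly => //; rewrite divr_gt0.
  apply: (@squeeze_cvgr _ _ _ _ (fun t => - (C * expR (- (delta / 2 * t))))
    (fun t => C * expR (- (delta / 2 * t)))) => //; last first.
    by rewrite -[X in _ --> X]oppr0; apply: cvgN.
  near=> t.
  have t0 : 0 <= t by near: t; apply: nbhs_pinfty_ge; exact: num_real.
  have ub k l : x t k 0 - x t l 0 <= C * expR (- (delta / 2 * t)).
    by rewrite expRN ler_pdivlMr ?expR_gt0// xC.
  by rewrite ub lerNl opprB ub.
apply: cvg_col_coord => i.
set c := (p *m x0) 0 0.
have -> : (c *: ones R n) i 0 = c + \sum_j p 0 j * 0.
  by rewrite !mxE mulr1 big1 ?addr0// => j _; rewrite mulr0.
have : c + \sum_j p 0 j * (x t i 0 - x t j 0) @[t --> +oo]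
    --> c + \sum_j p 0 j * 0.
  apply: cvgD; first exact: cvg_cst.
  apply: cvg_big => [|j _]; first exact: add_continuous.
  by apply: cvgMl_tmp; exact: spread0.
apply: cvg_trans; apply: near_eq_cvg; near=> t.
have t0 : 0 <= t by near: t; apply: nbhs_pinfty_ge; exact: num_real.
under eq_bigr do rewrite mulrBr.
rewrite sumrB -mulr_suml.
have -> : \sum_j p 0 j = (1 : 'M[R]_1) 0 0.
  have /matrixP/(_ 0 0) <- := consensus_row_ones n0 Llap d0; rewrite mxE.
  by apply: eq_bigr => j _; rewrite [X in _ * X]mxE mulr1.
have -> : \sum_j p 0 j * x t j 0 = c by rewrite /c -(pconst t)// [RHS]mxE.
by rewrite mxE mul1r addrC subrK.
Unshelve. all: by end_near. Qed.

(** * The limit as [delta] tends to 0 from the right *)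

Lemma resolvent_cvg_eigenprojection (R : realType) (n : nat) (L P : 'M[R]_n)
    (v : 'cV[R]_n) :
  (0 < n)%N -> is_laplacian L -> is_eigenprojection L P ->
  invmx (1%:M + delta^-1 *: L) *m v @[delta --> (0 : R)^'+] --> P *m v.
Proof.
move=> n0 Llap /(eigenprojection_laplacian n0 Llap) [LP /(_ v) [y vy]].
apply: cvg_col_coord => i; pose c := \sum_k `|y k 0|.
have dlim k : k * delta @[delta --> (0 : R)^'+] --> (0 : R).
  rewrite -[X in _ --> X](mulr0 k); apply: cvgMl_tmp.
  exact: cvg_at_right_filter.
have lim1 k : (P *m v) i 0 + k * delta @[delta --> (0 : R)^'+] --> (P *m v) i 0.
  by rewrite -[X in _ --> X]addr0; apply: cvgD => //; exact: cvg_cst.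
(* The coordinates of y and of its resolvent image are both bounded by c, uniformly in [delta], so
   the error is at most 2 c delta. *)
apply: squeeze_cvgr (lim1 (- (c + c))) (lim1 (c + c)).
near=> d.
have d0 : 0 < d by near: d; exact: nbhs_right_gt.
have dV0 : 0 <= d^-1 by rewrite invr_ge0 ltW.
set J := 1%:M + d^-1 *: L.
have Ju : J \in unitmx by exact: resolvent_unitmx.
have JP : invmx J *m (P *m v) = P *m v.
  rewrite -[X in invmx J *m X](_ : J *m (P *m v) = _) ?mulKmx//.
  by rewrite mulmxDl mul1mx -scalemxAl mulmxA LP mul0mx scaler0 addr0.
have Jv : invmx J *m v = P *m v + d *: (y - invmx J *m y).
  rewrite -[in LHS](subrK (P *m v) v) vy mulmxDr JP addrC; congr (_ + _).
  have -> : L *m y = d *: (J *m y - y).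
    rewrite mulmxDl mul1mx addrC addKr -scalemxAl scalerA.
    by rewrite divff ?scale1r// gt_eqF.
  by rewrite -scalemxAr mulmxBr mulKmx.
have yc k : `|y k 0| <= c by exact: coord_le_sum_norm.
have Jyc : `|(invmx J *m y) i 0| <= c.
  by apply: (@resolvent_bound _ _ L d^-1 _ _ y) => //; rewrite -/J mulKVmx.
have -> : (invmx J *m v) i 0 = (P *m v) i 0 + d * (y i 0 - (invmx J *m y) i 0).
  by rewrite Jv !mxE.
rewrite !lerD2l ![_ * d]mulrC !ler_pM2l// -ler_norml.
by rewrite (le_trans (ler_normB _ _))// lerD.
Unshelve. all: by end_near. Qed.

Theorem corollary2 (R : realType) (n : nat) (n_gt0 : (0 < n)%N)
    (L Jbar : 'M[R]_n) (L_lap : is_laplacian L)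
    (Jbar_proj : is_eigenprojection L Jbar)
    (x0 : 'cV[R]_n) (x : R -> R -> 'cV[R]_n)
    (x_sol : forall delta : R, 0 < delta ->
       is_linear_flow (- (L + delta *: centering_mx R n)) x0 (x delta)) :
  (forall delta : R, 0 < delta ->
     (1%:M + delta^-1 *: L \in unitmx) /\
     (x delta t @[t --> +oo] -->
       (n%:R^-1 * \sum_j (\sum_i invmx (1%:M + delta^-1 *: L) i j) * x0 j 0)
         *: ones R n)) /\
  (lim (x delta t @[t --> +oo]) @[delta --> 0^'+] -->
     (n%:R^-1 * \sum_j (\sum_i Jbar i j) * x0 j 0) *: ones R n).
Proof.
have cvgx delta : 0 < delta -> x delta t @[t --> +oo] -->
    (mean_row R n *m (invmx (1%:M + delta^-1 *: L) *m x0)) 0 0 *: ones R n.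
  by move=> d0; rewrite mulmxA; apply: flow_cvg (x_sol _ d0).
split=> [delta d0|].
  split; first by apply: resolvent_unitmx => //; rewrite invr_ge0 ltW.
  by rewrite -mean_row_mulE; exact: cvgx.
rewrite -mean_row_mulE.
have : (mean_row R n *m (invmx (1%:M + delta^-1 *: L) *m x0)) 0 0 *: ones R n
    @[delta --> 0^'+] --> (mean_row R n *m (Jbar *m x0)) 0 0 *: ones R n.
  apply: cvgZ; last exact: cvg_cst.
  by apply: cvg_row_mul; exact: resolvent_cvg_eigenprojection.
(* The inner limit is known only for positive [delta], which suffices near 0 from the right. *)
apply: cvg_trans; apply: near_eq_cvg; near=> delta.
apply/esym/cvg_lim => //.
by apply: cvgx; near: delta; exact: nbhs_right_gt.
Unshelve. all: by end_near. Qed.
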